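(* Consider a nonholonomic system with affine constraints $(L,Q,\mathcal{M})$, with constraint manifold $M\subset TQ$, which has a conserved moving energy $E_{L,Y_1}|_M$, for some vector field $Y_1$ on $Q$. Then, for any vector field $Y_2$ on $Q$, the moving energy $E_{L,Y_2}|_M$ is conserved if and only if $J_{Y_1-Y_2}|_M$ is a first integral of $(L,Q,\mathcal{M})$.
   Context: All objects are smooth and all vector fields are complete. $Q$ is an $n$-dimensional manifold. The Lagrangian $L:TQ\to\mathbb{R}$ has the form $L=T+b-V\circ\pi$, with $T$ the kinetic energy of a Riemannian metric on $Q$, $b$ a 1-form on $Q$ regarded as a function on $TQ$, $V$ a function on $Q$, and $\pi:TQ\to Q$ the projection. $\mathcal{D}$ is a nonintegrable distribution on $Q$ of constant rank $r$, $1<r<n$, and $Z$ is a vector field on $Q$. The affine constraint distribution $\mathcal{M}=Z+\mathcal{D}$ has fibers $\mathcal{M}_q=Z(q)+\mathcal{D}_q\subset T_qQ$; the submanifold $M\subset TQ$ with fibers $\mathcal{M}_q$ is the constraint manifold. The constraint is ideal (d'Alembert): the equations of motion are the restriction to $M$ of $\frac{d}{dt}\frac{\partial L}{\partial\dot q}-\frac{\partial L}{\partial q}=R$, where $R:M\to\mathcal{D}^\circ$, $R(v_q)\in\mathcal{D}_q^\circ$ (annihilator of $\mathcal{D}_q$), is the unique such function (the reaction force) for which these equations define a dynamics on $M$. A first integral of $(L,Q,\mathcal{M})$ (equivalently, a conserved function) is a function on $M$ constant along all solutions of the equations of motion. $p$ is the momentum 1-form generated by $L$ (in coordinates $p=\partial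 L/\partial\dot q$), $E_L:=\langle p,\cdot\rangle-L$ is the energy, and for a vector field $Y$ on $Q$, $J_Y:=\langle p,Y\rangle$ and $E_{L,Y}:=E_L-\langle p,Y\rangle$, as functions on $TQ$. A moving energy is a function on $M$ of the form $E_{L,Y}|_M$. *)

(* Defs.v *)
From mathcomp Require Import all_boot all_order all_algebra.
From mathcomp Require Import all_classical all_reals all_analysis.

Set Implicit Arguments.
Unset Strict Implicit.
Unset Printing Implicit Defensive.

Import Order.TTheory GRing.Theory Num.Theory.
Import numFieldNormedType.Exports.

Local Open Scope classical_set_scope.
Local Open Scope ring_scope.

(* For U open: f has continuous iterated directional derivatives on U up to
   order k. *)
Fixpoint class_C (R : realType) (V W : normedModType R) (k : nat)
    (U : set V) (f : V -> W) : Prop :=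
  (forall x, U x -> {for x, continuous f}) /\
  if k is k'.+1 then
    forall v, (forall x, U x -> derivable f x v) /\ class_C k' U ('D_v f)
  else True.

Definition smooth_on (R : realType) (V W : normedModType R)
    (U : set V) (f : V -> W) : Prop := forall k, class_C k U f.

(* A smooth atlas on a Hausdorff second countable space. chart_coord i and
   chart_param i are total functions, meaningful only on chart_dom i and on its
   image chart_codom i respectively. *)
Record manifold (R : realType) (n : nat) := Manifold {
  carrier :> topologicalType;
  manifold_hausdorff : hausdorff_space carrier;
  manifold_second_countable : @second_countable carrier;
  chart : Type;
  chart_dom : chart -> set carrier;
  chart_coord : chart -> carrier -> 'rV[R]_n;
  chart_param : chart -> 'rV[R]_n -> carrier;
  chart_at : carrier -> chart;
  dom_chart_at : forall q, chart_dom (chart_at q) q;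
  dom_open : forall i, open (chart_dom i);
  codom_open : forall i, open (chart_coord i @` chart_dom i);
  coordK : forall i q, chart_dom i q -> chart_param i (chart_coord i q) = q;
  coord_continuous : forall i q, chart_dom i q ->
    {for q, continuous (chart_coord i)};
  param_continuous : forall i x, (chart_coord i @` chart_dom i) x ->
    {for x, continuous (chart_param i)};
  transition_smooth : forall i j,
    smooth_on (chart_coord i @` (chart_dom i `&` chart_dom j))
      (chart_coord j \o chart_param i)
}.

Section Calculus.
Context {R : realType} {n : nat} {Q : manifold R n}.

Definition chart_codom (i : chart Q) : set 'rV[R]_n :=
  chart_coord i @` chart_dom i.

(* T_qQ is R^n, a vector being represented by its components in the preferred
   chart chart_at q; components and of_components below change to and from
   another chart. *)
Definition tangent (q : Q) : Type := 'rV[R]_n.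

Definition TQ : Type := {q : Q & tangent q}.

(* Components in the chart i of a vector at q. *)
Definition components (i : chart Q) (q : Q) (v : tangent q) : 'rV[R]_n :=
  'd (chart_coord i \o chart_param (chart_at q)) (chart_coord (chart_at q) q) v.

(* The vector at q whose components in the chart i are u. *)
Definition of_components (i : chart Q) (q : Q) (u : 'rV[R]_n) : tangent q :=
  'd (chart_coord (chart_at q) \o chart_param i) (chart_coord i q) u.

(* The point of TQ with induced coordinates (x, u) in the chart i. *)
Definition tangent_param (i : chart Q) (x u : 'rV[R]_n) : TQ :=
  existT _ (chart_param i x) (of_components i (chart_param i x) u).

Definition smooth_map (V : normedModType R) (U : set V) (f : V -> Q) : Prop :=
  (forall x, U x -> {for x, continuous f}) /\
  forall i, smooth_on (U `&` f @^-1` chart_dom i) (chart_coord i \o f).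

Definition tangent_map (V : normedModType R) (f : V -> Q) (x w : V) :
    tangent (f x) :=
  'd (chart_coord (chart_at (f x)) \o f) x w.

Definition velocity (c : R -> Q) (t : R) : tangent (c t) :=
  tangent_map (c : R^o -> Q) t 1.

Definition tangent_lift (c : R -> Q) (t : R) : TQ :=
  existT _ (c t) (velocity c t).

Definition smooth_curve (J : set R) (c : R -> Q) : Prop :=
  smooth_map (J : set R^o) c.

Definition smooth_function (f : Q -> R) : Prop :=
  forall i, smooth_on (chart_codom i) (f \o chart_param i : _ -> R^o).

Definition vector_field : Type := forall q : Q, tangent q.

Definition smooth_vector_field_on (U : set Q) (Y : vector_field) : Prop :=
  forall i, smooth_on (chart_coord i @` (chart_dom i `&` U))
    (fun x => components i (Y (chart_param i x))).

Definition complete_vector_field (Y : vector_field) : Prop :=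
  forall q, exists c : R -> Q,
    [/\ smooth_curve setT c, c 0 = q & forall t, velocity c t = Y (c t)].

Definition smooth_complete (Y : vector_field) : Prop :=
  smooth_vector_field_on setT Y /\ complete_vector_field Y.

Definition one_form : Type := forall q : Q, {linear tangent q -> R^o}.

Definition smooth_one_form (b : one_form) : Prop :=
  forall i (u : 'rV[R]_n),
    smooth_on (chart_codom i)
      (fun x => b (chart_param i x) (of_components i (chart_param i x) u)).

Record riemannian_metric (g : forall q : Q, tangent q -> tangent q -> R) :
    Prop := RiemannianMetric {
  metric_sym : forall q v w, g q v w = g q w v;
  metric_linear : forall q (a : R) (v v' w : tangent q),
    g q (a *: v + v') w = a * g q v w + g q v' w;
  metric_pos : forall q (v : tangent q), v != 0 -> 0 < g q v v;
  metric_smooth : forall i (u u' : 'rV[R]_n), smooth_on (chart_codom i)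
    (fun x => let q := chart_param i x in
       g q (of_components i q u) (of_components i q u') : R^o)
}.

Definition tangent_distribution : Type := forall q : Q, {vspace tangent q}.

Definition smooth_distribution (r : nat) (D : tangent_distribution) : Prop :=
  (forall q, \dim (D q) = r) /\
  forall q0, exists U (X : 'I_r -> vector_field),
    [/\ open U, U q0, (forall j, smooth_vector_field_on U (X j)) &
        forall q, U q -> D q = <<[seq X j q | j <- enum 'I_r]>>%VS].

(* Through every point passes an integral manifold, given parametrically; when
   D has rank r, f is automatically an immersion. *)
Definition integrable_distribution (r : nat) (D : tangent_distribution) :
    Prop :=
  forall q0, exists (W : set 'rV[R]_r) (f : 'rV[R]_r -> Q),
    [/\ open W, W 0, f 0 = q0, smooth_map W f &
        forall x, W x -> forall v : tangent (f x),
          v \in D (f x) <-> exists w, v = tangent_map f x w].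

Definition lagrangian (g : forall q : Q, tangent q -> tangent q -> R)
    (b : one_form) (V : Q -> R) (v : TQ) : R :=
  2^-1 * g (tag v) (tagged v) (tagged v) + b (tag v) (tagged v) - V (tag v).

(* The fibre derivative of L at v; in coordinates, p = dL/d(qdot). *)
Definition momentum (L : TQ -> R) (v : TQ) : {linear tangent (tag v) -> R^o} :=
  'd (fun u : tangent (tag v) => L (existT _ (tag v) u) : R^o) (tagged v).

Definition momentum_fun (L : TQ -> R) (Y : vector_field) (v : TQ) : R :=
  momentum L v (Y (tag v)).

Definition energy (L : TQ -> R) (v : TQ) : R := momentum L v (tagged v) - L v.

Definition moving_energy (L : TQ -> R) (Y : vector_field) (v : TQ) : R :=
  energy L v - momentum_fun L Y v.

Definition affine_constraint (Z : vector_field) (D : tangent_distribution) :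
    set TQ :=
  [set v | exists2 w, w \in D (tag v) & tagged v = Z (tag v) + w].

(* Only the values on the constraint manifold are meaningful. *)
Definition force : Type := forall v : TQ, {linear tangent (tag v) -> R^o}.

(* Smoothness on the submanifold M: in induced coordinates, F extends locally
   to a smooth function of (x, u). *)
Definition smooth_force (M : set TQ) (F : force) : Prop :=
  forall i x0 u0, chart_codom i x0 -> M (tangent_param i x0 u0) ->
  exists (N : set ('rV[R]_n * 'rV[R]_n)) (f : 'rV[R]_n * 'rV[R]_n -> 'rV[R]_n),
    [/\ open N, N (x0, u0), smooth_on N f &
        forall x u, N (x, u) -> chart_codom i x -> M (tangent_param i x u) ->
          forall k,
            F (tangent_param i x u)
              (of_components i (chart_param i x) (delta_mx 0 k))
            = f (x, u) 0 k].

(* Component k in the chart i of d/dt dL/d(qdot) - dL/dq, along c at time t. *)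
Definition euler_lagrange (L : TQ -> R) (c : R -> Q) (t : R) (i : chart Q)
    (k : 'I_n) : R :=
  let x := chart_coord i \o c in
  let Li y u : R^o := L (tangent_param i y u) in
  let x' : R -> 'rV[R]_n := derive1 x in
  derive1 (fun s => 'D_(delta_mx 0 k) (Li (x s)) (x' s)) t
  - 'D_(delta_mx 0 k) (Li ^~ (x' t)) (x t).

Definition solution (L : TQ -> R) (M : set TQ) (F : force)
    (J : set R) (c : R -> Q) : Prop :=
  smooth_curve J c /\
  forall t, J t -> M (tangent_lift c t) /\
    forall i, chart_dom i (c t) -> forall k,
      euler_lagrange L c t i k =
      F (tangent_lift c t) (of_components i (c t) (delta_mx 0 k)).

(* F is the reaction force: it annihilates D and makes the equations of motion
   a dynamics on M. As every vector field, the dynamical one is assumed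
   complete, so through each point of M passes a solution defined for all
   times. *)
Definition reaction_force (L : TQ -> R) (Z : vector_field)
    (D : tangent_distribution) (F : force) : Prop :=
  let M := affine_constraint Z D in
  [/\ smooth_force M F,
      forall v, M v -> forall w, w \in D (tag v) -> F v w = 0 &
      forall v, M v -> exists2 c, solution L M F setT c & tangent_lift c 0 = v].

End Calculus.

Arguments tangent {R n Q} q.
Arguments TQ {R n} Q.
Arguments vector_field {R n} Q.
Arguments one_form {R n} Q.
Arguments tangent_distribution {R n} Q.
Arguments force {R n} Q.

(* The reaction force is carried as data, being the only one (as a function on
   the constraint manifold) that satisfies reaction_force. *)
Record nonholonomic_system (R : realType) (n r : nat) (Q : manifold R n) :=
  NonholonomicSystem {
  metric : forall q : Q, tangent q -> tangent q -> R;
  gyro : one_form Q;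
  potential : Q -> R;
  constraint_distr : tangent_distribution Q;
  constraint_field : vector_field Q;
  reaction : force Q;
  sys_lagrangian := lagrangian metric gyro potential;
  metricP : riemannian_metric metric;
  gyro_smooth : smooth_one_form gyro;
  potential_smooth : smooth_function potential;
  rank_bounds : (1 < r < n)%N;
  constraint_distrP : smooth_distribution r constraint_distr;
  constraint_nonintegrable : ~ integrable_distribution r constraint_distr;
  constraint_fieldP : smooth_complete constraint_field;
  reactionP : reaction_force sys_lagrangian constraint_field constraint_distr
                reaction
}.

Definition constraint_manifold (R : realType) (n r : nat) (Q : manifold R n)
    (S : nonholonomic_system r Q) : set (TQ Q) :=
  affine_constraint (constraint_field S) (constraint_distr S).

(* f|_M is constant along all solutions; as these lie in M, only the
   restriction of f to the constraint manifold matters. *)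
Definition first_integral (R : realType) (n r : nat) (Q : manifold R n)
    (S : nonholonomic_system r Q) (f : TQ Q -> R) : Prop :=
  forall (J : set R) (c : R -> Q), open J -> is_interval J ->
    solution (sys_lagrangian S) (constraint_manifold S) (reaction S) J c ->
    forall s t, J s -> J t -> f (tangent_lift c s) = f (tangent_lift c t).

(* Main.v *)
Require Import Defs.
From mathcomp Require Import all_boot all_order all_algebra.
From mathcomp Require Import all_classical all_reals all_analysis.

(** The Lagrangian, and hence the energy, is the same for every moving energy:
    only the subtracted momentum depends on the vector field. As the momentum
    [momentum L v] is a linear form on the tangent space, two moving energies
    differ by the momentum of the difference of their vector fields
    ([moving_energy_change]), so along each solution one summand of
    [E_{L,Y2} = E_{L,Y1} + J_{Y1-Y2}] is constant, and the other summand is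
    constant if and only if the sum is ([first_integral_addl]). *)

Set Implicit Arguments.
Unset Strict Implicit.
Unset Printing Implicit Defensive.

Import Order.TTheory GRing.Theory Num.Theory.
Import numFieldNormedType.Exports.

Local Open Scope ring_scope.

(** The energy cancels in [E_{L,Y2} - E_{L,Y1}], which leaves the
    momentum evaluated on two vectors at the same point; linearity of
    [momentum L v] combines them. *)
Lemma moving_energy_change (R : realType) (n : nat) (Q : manifold R n)
    (L : TQ Q -> R) (Y1 Y2 : vector_field Q) (v : TQ Q) :
  moving_energy L Y2 v =
  moving_energy L Y1 v + momentum_fun L (fun q => Y1 q - Y2 q) v.
Proof. by rewrite /moving_energy /momentum_fun linearB addrA subrK. Qed.

Lemma first_integral_addl (R : realType) (n r : nat) (Q : manifold R n)
    (S : nonholonomic_system r Q) (f g : TQ Q -> R) :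
  first_integral S f ->
  first_integral S (fun v => f v + g v) <-> first_integral S g.
Proof.
have addl x y : f x = f y -> f x + g x = f y + g y <-> g x = g y.
  by move=> ->; split=> [|->//]; exact: addrI.
move=> hf; split=> hg J c oJ iJ sol s t Js Jt;
  have [cancel add] := addl _ _ (hf J c oJ iJ sol s t Js Jt).
  exact: cancel (hg J c oJ iJ sol s t Js Jt).
exact: add (hg J c oJ iJ sol s t Js Jt).
Qed.

Theorem proposition6 (R : realType) (n r : nat) (Q : manifold R n)
    (S : nonholonomic_system r Q) (Y1 : vector_field Q)
    (hY1 : smooth_complete Y1)
    (hE1 : first_integral S (moving_energy (sys_lagrangian S) Y1))
    (Y2 : vector_field Q) (hY2 : smooth_complete Y2) :
  first_integral S (moving_energy (sys_lagrangian S) Y2) <->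
  first_integral S
    (momentum_fun (sys_lagrangian S) (fun q => Y1 q - Y2 q)).
Proof.
have -> : moving_energy (sys_lagrangian S) Y2 =
    (fun v => moving_energy (sys_lagrangian S) Y1 v +
       momentum_fun (sys_lagrangian S) (fun q => Y1 q - Y2 q) v).
  by apply: funext => v; exact: moving_energy_change.
exact: first_integral_addl.
Qed.
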